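(* Let $n\ge 4$. Then $\mathrm{rank}(IOF_n^{par})=3n-6$.
   Context: Let $\overline{n}=\{1,\dots,n\}$. $I_n$ is the symmetric inverse semigroup (a monoid under composition) of all partial injections of $\overline{n}$ (including the empty map), maps written on the right and composed left to right. The fence (zig-zag order) on $\overline{n}$ is $1\prec 2\succ 3\prec 4\succ\cdots$, i.e. $x\prec y$ iff $x$ is odd, $y$ is even and $|x-y|=1$. A map $\alpha\in I_n$ is fence-preserving if $x\prec y$ implies $x\alpha\prec y\alpha$ for all $x,y\in dom(\alpha)$; $PFI_n$ is the monoid of all fence-preserving $\alpha\in I_n$. $IOF_n^{par}$ is the set of all $\alpha\in PFI_n$ that are regular in $PFI_n$ (equivalently, $\alpha^{-1}\in PFI_n$), order-preserving ($x<y$ implies $x\alpha\le y\alpha$ for all $x,y\in dom(\alpha)$) and parity-preserving ($x$ and $x\alpha$ have the same parity for all $x\in dom(\alpha)$). It is an inverse submonoid of $I_n$. For a non-empty subset $A$ of a semigroup $S$, $\langle A\rangle$ denotes the subsemigroup generated by $A$, i.e. the smallest subsemigroup of $S$ containing $A$; the rank of a finitely generated semigroup $S$ is $\mathrm{rank}(S)=\min\{|A| : \langle A\rangle=S\}$.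
   Formalization: The rank is taken with respect to generation as a monoid (the identity is free) rather than as a semigroup: the identity is not a product of other elements of IOF_n^par, so it lies in every semigroup generating set and the semigroup rank is 3n-5, e.g. 7 and not 6 for n=4. *)

(* Defs.v *)
From HB Require Import structures.
From mathcomp Require Import all_boot.
From mathcomp Require Import monoid.

Set Implicit Arguments.
Unset Strict Implicit.
Unset Printing Implicit Defensive.

Local Open Scope group_scope.

(* A partial injection a : [a x = Some y] when x is in the domain and y is its
   image, [a x = None] when x is outside the domain. *)
Definition partial_injective n (f : {ffun 'I_n -> option 'I_n}) : bool :=
  dinjectiveb f [pred x | isSome (f x)].

Record pinj (n : nat) := PInj {
  pfun :> {ffun 'I_n -> option 'I_n};
  _ : partial_injective pfun
}.

HB.instance Definition _ n := [isSub for @pfun n].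
HB.instance Definition _ n := [Finite of pinj n by <:].

Section Composition.
Variable n : nat.
Implicit Types a b c : pinj n.

Lemma pinj_inj a x y z : a x = Some z -> a y = Some z -> x = y.
Proof.
move=> ax ay; have /dinjectiveP := valP a; apply; rewrite ?inE ?ax ?ay //.
Qed.

Lemma pinjP a b : (forall x, a x = b x) -> a = b.
Proof. by move=> ab; apply/val_inj/ffunP. Qed.

Lemma pcomp_subproof a b : partial_injective [ffun x => obind b (a x)].
Proof.
apply/dinjectiveP => x y; rewrite !inE !ffunE.
case ax: (a x) => [x'|] //=; case ay: (a y) => [y'|] //=.
case bx: (b x') => [z|] //= _; case by_: (b y') => [z'|] //= _ [zz].
rewrite -zz in by_; move: ax; rewrite (pinj_inj bx by_) => ax.
exact: pinj_inj ax ay.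
Qed.

(* Left-to-right composition: x (a b) = (x a) b. *)
Definition pcomp a b : pinj n := PInj (pcomp_subproof a b).

Lemma pid_subproof : partial_injective [ffun x : 'I_n => Some x].
Proof. by apply/dinjectiveP => x y _ _; rewrite !ffunE => -[]. Qed.

Definition pid : pinj n := PInj pid_subproof.

Lemma pcompA : associative pcomp.
Proof. by move=> a b c; apply: pinjP => x; rewrite !ffunE; case: (a x) => //= y; rewrite ffunE. Qed.

Lemma pcomp1p : left_id pid pcomp.
Proof. by move=> a; apply: pinjP => x; rewrite !ffunE. Qed.

Lemma pcompp1 : right_id pid pcomp.
Proof. by move=> a; apply: pinjP => x; rewrite !ffunE; case: (a x) => //= y; rewrite ffunE. Qed.

End Composition.

HB.instance Definition _ n :=
  isMonoid.Build (pinj n) (@pcompA n) (@pcomp1p n) (@pcompp1 n).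

(* The ordinal i : 'I_n, i = 0, ..., n-1, stands for the point i + 1. *)
Definition point n (i : 'I_n) : nat := i.+1.

Definition fence n : rel 'I_n := fun i j =>
  let x := point i in let y := point j in
  [&& odd x, ~~ odd y & (y == x.+1) || (x == y.+1)].

Definition preserves n (r s : rel 'I_n) (a : pinj n) : bool :=
  [forall x, forall y, forall x', forall y',
    [&& a x == Some x', a y == Some y' & r x y] ==> s x' y'].

Definition fence_preserving n (a : pinj n) : bool :=
  preserves (@fence n) (@fence n) a.

Definition order_preserving n (a : pinj n) : bool :=
  preserves (fun x y : 'I_n => x < y) (fun x y : 'I_n => x <= y) a.

Definition parity_preserving n (a : pinj n) : bool :=
  [forall x, forall x',
    (a x == Some x') ==> (odd (point x') == odd (point x))].

Definition PFI n : {set pinj n} := [set a | fence_preserving a].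

Definition regular_in n (S : {set pinj n}) (a : pinj n) : bool :=
  [exists b in S, a * b * a == a].

Definition IOFpar n : {set pinj n} :=
  [set a in PFI n |
    [&& regular_in (PFI n) a, order_preserving a & parity_preserving a]].

Definition submonoid n (B : {set pinj n}) : bool :=
  (1 \in B) && [forall a in B, forall b in B, a * b \in B].

(* The smallest submonoid containing A: the identity is the empty product, so
   it comes for free.  Generating by nonempty products only would force 1, the
   only unit of IOFpar n, into every generating set and raise the rank of
   IOFpar n by one. *)
Definition generated n (A : {set pinj n}) : {set pinj n} :=
  \bigcap_(B : {set pinj n} | submonoid B && (A \subset B)) B.

Lemma generated_id n (S : {set pinj n}) : submonoid S -> generated S = S.
Proof.
move=> mS; apply/eqP; rewrite eqEsubset; apply/andP; split.
  by apply: bigcap_inf; rewrite mS subxx.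
by apply/bigcapsP => B /andP[].
Qed.

(* The minimum is over a nonempty family when S is a submonoid, since then S
   generates itself. *)
Definition rank n (S : {set pinj n}) : nat :=
  #|[arg min_(A < S | generated A == S) #|A| ]|.

Section Submonoid.
Variable n : nat.
Implicit Types a b c : pinj n.

Lemma preservesP (r s : rel 'I_n) a :
  reflect (forall x y x' y', a x = Some x' -> a y = Some y' -> r x y -> s x' y')
          (preserves r s a).
Proof.
apply: (iffP idP) => [H x y x' y' /eqP ax /eqP ay rxy|H].
  move: H => /forallP/(_ x)/forallP/(_ y)/forallP/(_ x')/forallP/(_ y').
  by move/implyP; apply; rewrite ax ay.
do 4!apply/forallP => ?; apply/implyP => /and3P[/eqP ax /eqP ay]; exact: H.
Qed.

Lemma parity_preservingP a :
  reflect (forall x x', a x = Some x' -> odd (point x') = odd (point x))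
          (parity_preserving a).
Proof.
apply: (iffP idP) => [H x x' /eqP ax|H].
  by move: H => /forallP/(_ x)/forallP/(_ x')/implyP/(_ ax)/eqP.
by do 2!apply/forallP => ?; apply/implyP => /eqP /H ->.
Qed.

Lemma mulpE a b x : (a * b) x = obind b (a x).
Proof. by rewrite ffunE. Qed.

Lemma mulpP a b x z :
  (a * b) x = Some z -> exists2 y, a x = Some y & b y = Some z.
Proof. by rewrite mulpE; case ax: (a x) => [y|] //= bz; exists y. Qed.

Lemma pinv_subproof a : partial_injective [ffun y => [pick x | a x == Some y]].
Proof.
apply/dinjectiveP => y z; rewrite !inE !ffunE.
case: pickP => [x /eqP ax|] // _; case: pickP => [x' /eqP ax'|] // _ [xx].
by move: ax'; rewrite -xx ax => -[].
Qed.

Definition pinv a : pinj n := PInj (pinv_subproof a).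

Lemma pinvE a x y : (pinv a y = Some x) <-> (a x = Some y).
Proof.
rewrite ffunE; case: pickP => [x' /eqP ax'|none]; split=> //.
- by case=> <-.
- by move=> ax; congr Some; apply: pinj_inj ax' ax.
by move=> ax; have := none x; rewrite ax eqxx.
Qed.

(* Regularity in PFI n amounts to the inverse being fence-preserving. *)
Lemma regular_PFI a : regular_in (PFI n) a = fence_preserving (pinv a).
Proof.
apply/idP/idP => [/exists_inP[b]|H].
  rewrite inE => /preservesP fb /eqP aba; apply/preservesP => y1 y2 x1 x2.
  have bK x y : a x = Some y -> b y = Some x.
    move=> ax; have: (a * b * a) x = Some y by rewrite aba.
    case/mulpP => x'; case/mulpP => y'; rewrite ax => -[<-] bx' ax'.
    by rewrite bx' (pinj_inj ax' ax).
  by move=> /pinvE/bK b1 /pinvE/bK b2; apply: fb.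
apply/exists_inP; exists (pinv a); first by rewrite inE.
apply/eqP/pinjP => x; rewrite !mulpE; case ax: (a x) => [y|] //=.
by rewrite (iffRL (pinvE _ _ _) ax) /= ax.
Qed.

Lemma IOFpar_submonoid : submonoid (IOFpar n).
Proof.
apply/andP; split.
  have id1 x : (1 : pinj n) x = Some x by rewrite ffunE.
  have idV x x' : pinv 1 x = Some x' -> x' = x.
    by move/pinvE; rewrite id1 => -[].
  rewrite !inE regular_PFI; apply/and4P; split.
  - by apply/preservesP => x y x' y'; rewrite !id1 => -[<-] [<-].
  - by apply/preservesP => x y x' y' /idV-> /idV->.
  - by apply/preservesP => x y x' y'; rewrite !id1 => -[<-] [<-] /ltnW.
  - by apply/parity_preservingP => x x'; rewrite id1 => -[<-].
apply/forall_inP => a aS; apply/forall_inP => b bS; move: aS bS.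
rewrite !inE !regular_PFI.
move=> /and4P[/preservesP fa /preservesP va /preservesP oa /parity_preservingP pa].
move=> /and4P[/preservesP fb /preservesP vb /preservesP ob /parity_preservingP pb].
apply/and4P; split.
- apply/preservesP => x y x' y' /mulpP[u ax bu] /mulpP[v ay bv] /(fa _ _ _ _ ax ay).
  exact: fb.
- apply/preservesP => x y x' y'.
  move=> /pinvE/mulpP[u /pinvE ax /pinvE bu] /pinvE/mulpP[v /pinvE ay /pinvE bv].
  by move=> /(vb _ _ _ _ bu bv); apply: va.
- apply/preservesP => x y x' y' /mulpP[u ax bu] /mulpP[v ay bv] xy.
  have := oa _ _ _ _ ax ay xy; rewrite leq_eqVlt => /orP[/eqP/val_inj uv|].
    by move: bu; rewrite uv bv => -[->].
  exact: ob.
- apply/parity_preservingP => x x' /mulpP[u ax bu].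
  by rewrite (pb _ _ bu) (pa _ _ ax).
Qed.

End Submonoid.

(* Main.v *)
(* An element of IOF_n^par is an increasing, parity-preserving partial injection
   that preserves and reflects adjacency.  For a cut point c, let D_c be the set
   of points x <= c or x >= c + 4, and let s_c move the points up to c by +2 and
   fix those from c + 4 on.  Generators are the n restrictions of the identity
   to complements of points, and s_c and its inverse for n - 3 cut points c.

   They generate: if x is the largest point moved by a and, up to inversion, a
   moves x upwards, then the next point of the domain is at least x + 4, so a
   factors through s_x, and the remaining factor has its domain closer to the
   top.

   No fewer elements suffice: a domain leaving no three consecutive points out
   (with 0 and n + 1 counted as left out) admits only the identity, because
   distances up to 3 cannot shrink.  Hence each of the following 3n - 6
   pairwise disjoint classes has a submonoid as its complement and must be met:
   the n singletons of restrictions to complements of points, and, for each c,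
   the non-identical maps with domain D_c and those with image D_c. *)

Require Import Defs.
From mathcomp Require Import all_boot.
From mathcomp Require Import monoid zify.

Set Implicit Arguments.
Unset Strict Implicit.
Unset Printing Implicit Defensive.

Section PartialInjections.
Local Open Scope group_scope.
Variable n : nat.
Implicit Types (a b : pinj n) (D E : {set 'I_n}) (A B C S : {set pinj n}).

(** * Domains, moved points and restrictions of the identity *)

Definition pdom a : {set 'I_n} := [set x | isSome (a x)].

Lemma pdomP a x : reflect (exists y, a x = Some y) (x \in pdom a).
Proof.
rewrite inE; case: (a x) => [y|] /=; constructor; first by exists y.
by case.
Qed.

Lemma mem_pdom a x y : a x = Some y -> x \in pdom a.
Proof. by rewrite inE => ->. Qed.

Lemma pidE x : (1 : pinj n) x = Some x.
Proof. by rewrite ffunE. Qed.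

Lemma mulp_some a b x y : a x = Some y -> (a * b) x = b y.
Proof. by move=> ax; rewrite mulpE ax. Qed.

Lemma pinvK : involutive (@pinv n).
Proof.
move=> a; apply: pinjP => x; case E: (a x) => [y|].
  by apply/pinvE/pinvE.
case E': (pinv (pinv a) x) => [y|] //.
by move/pinvE/pinvE: E'; rewrite E.
Qed.

Lemma pinvM a b : pinv (a * b) = pinv b * pinv a.
Proof.
apply: pinjP => z.
have H x : (pinv (a * b) z = Some x) <-> ((pinv b * pinv a) z = Some x).
  split=> [/pinvE/mulpP[y ay bz]|/mulpP[y /pinvE bz /pinvE ay]].
    by rewrite mulpE (iffRL (pinvE _ _ _) bz) /=; apply/pinvE.
  by apply/pinvE; rewrite mulpE ay.
case E: (pinv (a * b) z) => [x|]; first by move/H: E.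
by case E': ((pinv b * pinv a) z) => [x|] //; move/H: E'; rewrite E.
Qed.

Definition moves a : bool := [exists x, (x \in pdom a) && (a x != Some x)].

Lemma movesP a :
  reflect (exists x y, a x = Some y /\ y != x) (moves a).
Proof.
apply: (iffP existsP) => [[x /andP[/pdomP[y ax]]]|[x [y [ax yx]]]].
  by rewrite ax => yx; exists x, y; split=> //; apply: contraNneq yx => ->.
exists x; rewrite (mem_pdom ax) ax; apply: contraNneq yx.
by case=> ->.
Qed.

Lemma fixes_pdom a x y : ~~ moves a -> a x = Some y -> y = x.
Proof.
move=> am ax; apply/eqP; apply: contraNT am => yx.
by apply/movesP; exists x, y.
Qed.

Lemma moves_pinv a : moves (pinv a) = moves a.
Proof.
apply/movesP/movesP => -[x [y [/pinvE ax yx]]].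
  by exists y, x; rewrite eq_sym.
by exists y, x; rewrite eq_sym.
Qed.

Lemma restr_subproof D :
  partial_injective [ffun x => if x \in D then Some x else None].
Proof.
apply/dinjectiveP => x y; rewrite !inE !ffunE.
by case: ifP => // _ _; case: ifP => // _ _ [].
Qed.

Definition restr D : pinj n := PInj (restr_subproof D).

Lemma restrE D x : restr D x = if x \in D then Some x else None.
Proof. by rewrite ffunE. Qed.

Lemma pdom_restr D : pdom (restr D) = D.
Proof. by apply/setP => x; rewrite inE restrE; case: ifP. Qed.

Lemma moves_restr D : ~~ moves (restr D).
Proof.
by apply/movesP => -[x [y []]]; rewrite restrE; case: ifP => // _ [->]; rewrite eqxx.
Qed.

Lemma restr_pdom a : ~~ moves a -> a = restr (pdom a).
Proof.
move=> am; apply: pinjP => x; rewrite restrE inE.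
by case ax: (a x) => [y|] //=; rewrite (fixes_pdom am ax).
Qed.

Lemma restrI D E : restr D * restr E = restr (D :&: E).
Proof.
by apply: pinjP => x; rewrite mulpE !restrE inE; case: ifP => //= _; rewrite restrE.
Qed.

Lemma restrT : restr setT = 1.
Proof. by apply: pinjP => x; rewrite restrE pidE inE. Qed.

(** * Generated submonoids *)

Lemma sub_generated A : A \subset generated A.
Proof. by apply/bigcapsP => B /andP[]. Qed.

Lemma generated_submonoid A : submonoid (generated A).
Proof.
apply/andP; split; first by apply/bigcapP => B /andP[/andP[]].
apply/forall_inP => a aA; apply/forall_inP => b bA.
apply/bigcapP => B BA; have /andP[/andP[_ /forall_inP mB] _] := BA.
move/bigcapP: aA => /(_ B BA) aB; move/bigcapP: bA => /(_ B BA) bB.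
exact: (forall_inP (mB a aB)).
Qed.

Lemma submonoidM S a b : submonoid S -> a \in S -> b \in S -> a * b \in S.
Proof. by case/andP=> _ /forall_inP H aS; apply: (forall_inP (H a aS)). Qed.

Lemma generated_min A B : submonoid B -> A \subset B -> generated A \subset B.
Proof. by move=> mB AB; apply: bigcap_inf; rewrite mB. Qed.

(** Inversion reverses products and fixes [1], so the elements with a generated inverse form a
    submonoid. *)
Lemma generated_pinv A a :
  (forall b, b \in A -> pinv b \in generated A) ->
  a \in generated A -> pinv a \in generated A.
Proof.
move=> AV aA; have mA := generated_submonoid A.
suff /subsetP/(_ a aA) : generated A \subset [set b | pinv b \in generated A].
  by rewrite inE.
apply: generated_min; last by apply/subsetP => b /AV; rewrite inE.
have pinv1 : pinv 1 = 1 :> pinj n.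
  by apply: pinjP => x; rewrite pidE; apply/pinvE; rewrite pidE.
apply/andP; split; first by rewrite inE pinv1; case/andP: mA.
apply/forall_inP => b; rewrite inE => bA; apply/forall_inP => c; rewrite inE => cA.
by rewrite inE pinvM submonoidM.
Qed.

Lemma prime_class_meets S A C c :
    submonoid S -> generated A = S -> c \in S -> c \in C -> 1 \notin C ->
    {in S &, forall a b, a * b \in C -> (a \in C) || (b \in C)} ->
  exists2 a, a \in A & a \in C.
Proof.
(* The complement of C in S is a proper submonoid. *)
move=> mS AS cS cC C1 prC.
case: (boolP [exists a in A, a \in C]) => [/exists_inP //|nAC].
suff /subsetP/(_ c) : generated A \subset S :\: C by rewrite AS inE cC => /(_ cS).
apply: generated_min; last first.
  apply/subsetP => a aA; rewrite inE; apply/andP; split.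
    by apply: contra nAC => aC; apply/exists_inP; exists a.
  by rewrite -AS; apply: (subsetP (sub_generated A)).
apply/andP; split; first by rewrite inE C1; case/andP: mS.
apply/forall_inP => a; rewrite inE => /andP[aC aS].
apply/forall_inP => b; rewrite inE => /andP[bC bS].
rewrite inE (submonoidM mS) // andbT; apply/negP => /(prC a b aS bS).
by rewrite (negbTE aC) (negbTE bC).
Qed.

(** * Membership in [IOFpar n] through order, parity and adjacency *)

Lemma fence_lt (x y : 'I_n) : x < y ->
  (fence x y = [&& ~~ odd x, odd y & y == x.+1 :> nat]) *
  (fence y x = [&& ~~ odd y, odd x & y == x.+1 :> nat]).
Proof.
move=> xy; rewrite /fence /point /= !negbK !eqSS.
have -> : (x == y.+1 :> nat) = false by rewrite ltn_eqF // ltnW.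
by rewrite orbF.
Qed.

Lemma fence_succ (x y : 'I_n) : x < y -> (y == x.+1 :> nat) = fence x y || fence y x.
Proof.
move=> xy; rewrite !(fence_lt xy); have [->|_] := eqVneq (y : nat) x.+1.
  by rewrite /=; case: (odd x).
by rewrite !andbF.
Qed.

(** Parity decides which of two adjacent points is the lower one in the fence, so preserving the
    fence by the map and by its inverse amounts to preserving and reflecting adjacency. Passing from
    points to ordinals flips every parity, which changes nothing. *)
Lemma IOFparP a :
  reflect ((forall x x', a x = Some x' -> odd x' = odd x) /\
           (forall x y x' y', a x = Some x' -> a y = Some y' -> x < y ->
              x' < y' /\ (y == x.+1 :> nat) = (y' == x'.+1 :> nat)))
          (a \in IOFpar n).
Proof.
rewrite !inE regular_PFI; apply: (iffP and4P) => [[/preservesP fa /preservesP va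
   /preservesP oa /parity_preservingP pa]|[pa ra]].
  split=> [x x' /pa|x y x' y' ax ay xy]; first by rewrite /point /= => /negb_inj.
  have xy' : x' < y'.
    rewrite ltn_neqAle (oa _ _ _ _ ax ay xy) andbT.
    apply/eqP => /val_inj xy'; move: xy.
    by rewrite -xy' in ay; rewrite (pinj_inj ax ay) ltnn.
  have vx := iffRL (pinvE _ _ _) ax; have vy := iffRL (pinvE _ _ _) ay.
  split=> //; rewrite !fence_succ //; congr (_ || _).
    by apply/idP/idP; [apply: fa|apply: va].
  by apply/idP/idP; [apply: fa|apply: va].
have fen x y x' y' : a x = Some x' -> a y = Some y' -> fence x y = fence x' y'.
  move=> ax ay; have [xy|yx|/val_inj eq] := ltngtP x y.
  - have [xy' succ] := ra _ _ _ _ ax ay xy.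
    by rewrite (fence_lt xy) (fence_lt xy') succ (pa _ _ ax) (pa _ _ ay).
  - have [yx' succ] := ra _ _ _ _ ay ax yx.
    by rewrite (fence_lt yx) (fence_lt yx') succ (pa _ _ ax) (pa _ _ ay).
  move: ay; rewrite -eq ax => -[<-].
  by rewrite /fence !andbA !andbN.
split.
- by apply/preservesP => x y x' y' ax ay; rewrite (fen _ _ _ _ ax ay).
- by apply/preservesP => x y x' y' /pinvE ax /pinvE ay; rewrite (fen _ _ _ _ ax ay).
- by apply/preservesP => x y x' y' ax ay /(ra _ _ _ _ ax ay)[/ltnW].
- by apply/parity_preservingP => x x' /pa; rewrite /point /= => ->.
Qed.

Lemma IOFpar_pinv a : a \in IOFpar n -> pinv a \in IOFpar n.
Proof.
move=> /IOFparP[pa ra]; apply/IOFparP; split=> [x x' /pinvE/pa //|].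
move=> x y x' y' /pinvE ax /pinvE ay xy.
have [lt|lt|/val_inj eq] := ltngtP x' y'.
- by have [_ ->] := ra _ _ _ _ ax ay lt.
- by have [] := ra _ _ _ _ ay ax lt; lia.
by move: xy; rewrite eq ay in ax; case: ax => ->; rewrite ltnn.
Qed.

Lemma restr_IOFpar D : restr D \in IOFpar n.
Proof.
apply/IOFparP; split=> [x x'|x y x' y']; rewrite !restrE; case: ifP => // _ [<-] //.
by case: ifP => // _ [<-].
Qed.

Lemma IOFparM a b : a \in IOFpar n -> b \in IOFpar n -> a * b \in IOFpar n.
Proof. exact/submonoidM/IOFpar_submonoid. Qed.

(** * Rigidity: elements forced to fix their domain *)

(** An increasing bijection of a finite chain onto itself is the identity; the induction climbs the
    chain. *)
Lemma pdom_pinv_fixes a :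
  a \in IOFpar n -> pdom (pinv a) = pdom a -> ~~ moves a.
Proof.
move=> /IOFparP[_ ra] da.
suff fixa m (x y : 'I_n) : x < m -> a x = Some y -> y = x.
  by apply/movesP => -[x [y [ax]]]; rewrite (fixa x.+1 x y _ ax) ?eqxx.
elim: m x y => // m IHm x y; rewrite ltnS => xm ax.
have [lt|lt|/val_inj //] := ltngtP y x.
  have /pdomP[z ay] : y \in pdom a.
    by rewrite -da; apply/pdomP; exists x; apply/pinvE.
  have zy : z = y by apply: IHm ay; apply: leq_trans xm.
  by rewrite zy in ay; apply: pinj_inj ay ax.
have /pdomP[z /pinvE az] : x \in pdom (pinv a) by rewrite da (mem_pdom ax).
have [zx|xz|/val_inj zx] := ltngtP z x.
- by have zx' := IHm z x (leq_trans zx xm) az; rewrite -zx' ltnn in zx.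
- by have [] := ra _ _ _ _ ax az xz; lia.
by move: az; rewrite zx ax => -[].
Qed.

(* Read with one missing point added on each side of the chain, the condition
   says that D leaves no gap of three consecutive points. *)
Definition dense D : Prop :=
  [/\ exists2 x, x \in D & x <= 1, exists2 x, x \in D & n <= x + 2 &
      {in D &, forall x y : 'I_n, x + 3 < y ->
        exists2 z, z \in D & x < z <= x + 3}].

(** Reflecting adjacency keeps a distance 2 or 3 from becoming 1, and parity keeps 3 from becoming
    2. *)
Lemma short_distance (x y x' y' : nat) :
    x < y -> y <= x + 3 -> x' < y' -> odd x' = odd x -> odd y' = odd y ->
    (y == x.+1) = (y' == x'.+1) ->
  y - x <= y' - x' /\ x' <= y'.
Proof.
move=> xy y3 xy' px py succ; split; last exact: ltnW.
rewrite leqNgt; apply/negP => lt.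
have [y1|y1] := eqVneq y' x'.+1.
  by move: succ; rewrite y1 eqxx => /eqP; lia.
have [ey' ey] : y' = x' + 2 /\ y = x + 3 by clear px py succ; lia.
by move: py; rewrite ey' ey !oddD px addbF addbT; case: (odd x).
Qed.

(* Distances up to 3 cannot shrink, so along a dense domain no distance
   shrinks, and by parity the ends cannot move outwards. *)
Lemma dense_fixes a : a \in IOFpar n -> dense (pdom a) -> ~~ moves a.
Proof.
move=> /IOFparP[pa ra] [[l lD l1] [h hD hn] gap].
have expand m (x y x' y' : 'I_n) :
    y - x <= m -> a x = Some x' -> a y = Some y' -> x <= y ->
    y - x <= y' - x' /\ x' <= y'.
  elim: m x y x' y' => [|m IHm] x y x' y' yx ax ay xy.
    have eq : x = y by apply: val_inj => /=; lia.
    by move: ay; rewrite -eq ax => -[->]; lia.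
  have [near|far] := leqP y (x + 3).
    have [eq|ne] := eqVneq x y; first by move: ay; rewrite -eq ax => -[->]; lia.
    have lt : x < y by rewrite ltn_neqAle xy andbT.
    have [lt' succ] := ra _ _ _ _ ax ay lt.
    exact: short_distance lt near lt' (pa _ _ ax) (pa _ _ ay) succ.
  have [z /pdomP[z' az] /andP[xz zx]] := gap x y (mem_pdom ax) (mem_pdom ay) far.
  have [] := IHm x z x' z' _ ax az _; try lia.
  have [] := IHm z y z' y' _ az ay _; lia.
apply/movesP => -[x [y [ax /eqP[]]]]; apply: val_inj; apply/eqP.
case/pdomP: lD => l' al; case/pdomP: hD => h' ah.
move: (pa _ _ al) (pa _ _ ah) (pa _ _ ax).
move: (ltn_ord h) (ltn_ord h') (ltn_ord x) (ltn_ord y).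
rewrite eqn_leq => ? ? ? ? pl ph px; apply/andP; split=> /=.
  (* [h] is one of the last two points, so parity gives [h' <= h]; the distance from [x] to [h] does
     not shrink, hence [y <= x]. The low end [l] gives the converse. *)
  case: (leqP x h) => xh; last by lia.
  by have [] := expand (h - x) x h y h' (leqnn _) ax ah xh; lia.
case: (leqP l x) => lx; last by lia.
by have [] := expand (x - l) l x l' y (leqnn _) al ax lx; lia.
Qed.

(** * Prime classes in [IOFpar n] *)

Lemma pdomM_sub a b : pdom (a * b) \subset pdom a.
Proof. by apply/subsetP => x /pdomP[y /mulpP[z az _]]; apply: mem_pdom az. Qed.

Definition movers D : {set pinj n} :=
  [set a in IOFpar n | (pdom a == D) && moves a].

Lemma in_movers D a :
  (a \in movers D) = [&& a \in IOFpar n, pdom a == D & moves a].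
Proof. by rewrite in_set. Qed.

(** A factor that moves a point has no dense domain, so if its domain contains [D] it is [D]. When
    [a] fixes its domain, [b] agrees with [a * b] on [D] and is the moving factor. *)
Lemma movers_prime D :
    (forall E, D \proper E -> dense E) ->
  {in IOFpar n &, forall a b, a * b \in movers D -> (a \in movers D) || (b \in movers D)}.
Proof.
move=> denseD a b aS bS; rewrite !in_movers aS bS /= => /and3P[_ /eqP dab mab].
have Da : D \subset pdom a by rewrite -dab pdomM_sub.
have [ma|ma] := boolP (moves a).
  suff -> : pdom a == D by [].
  apply: contraTT ma => daD; apply: dense_fixes => //; apply: denseD.
  by rewrite properEneq Da andbT eq_sym.
rewrite andbF /=.
have bab x y : (a * b) x = Some y -> b x = Some y.
  by case/mulpP => z /(fixes_pdom ma) ->.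
have mb : moves b.
  by case/movesP: mab => x [y [/bab bx yx]]; apply/movesP; exists x, y.
rewrite mb andbT; apply: contraTT mb => dbD; apply: dense_fixes => //.
apply: denseD; rewrite properEneq eq_sym dbD /=.
by apply/subsetP => x; rewrite -dab => /pdomP[y /bab]; apply: mem_pdom.
Qed.

(** The domain of [a] is dense, so [a] is the restriction itself or [1]; in the latter case [b] is
    the product. *)
Lemma coatom_prime i :
    dense [set~ i] -> dense [set: 'I_n] ->
  {in IOFpar n &, forall a b, a * b \in [set restr [set~ i]] ->
     (a \in [set restr [set~ i]]) || (b \in [set restr [set~ i]])}.
Proof.
move=> di dT a b aS bS; rewrite !inE => /eqP ab.
have da : [set~ i] \subset pdom a by rewrite -(pdom_restr [set~ i]) -ab pdomM_sub.
have : pdom a = [set~ i] \/ pdom a = setT.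
  case: (boolP (i \in pdom a)) => ia; [right|left].
    apply/setP => x; rewrite [RHS]inE; have [->//|xi] := eqVneq x i.
    by apply: (subsetP da); rewrite !inE.
  apply/eqP; rewrite eqEsubset da andbT; apply/subsetP => x xa.
  by rewrite !inE; apply: contraNneq ia => <-.
case=> eda; have ma : ~~ moves a by apply: dense_fixes; rewrite // eda.
  by rewrite (restr_pdom ma) eda eqxx.
have a1 : a = 1 by rewrite (restr_pdom ma) eda restrT.
by move: ab; rewrite a1 mul1g => ->; rewrite eqxx orbT.
Qed.

(** * Shifts and their two-block domains *)

(** [c + 4] is the first point that can stay fixed: a fixed [c + 3] would become adjacent to
    [c + 2], the image of [c]. [insub] drops points pushed beyond the chain. *)
Lemma shift_subproof c :
  partial_injective [ffun x : 'I_n => if x <= c then insub x.+2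
                                      else if c + 4 <= x then Some x else None].
Proof.
apply/dinjectiveP => x y; rewrite !inE !ffunE.
case: (leqP x c) => xc; case: (leqP y c) => yc.
- case: insubP => // u _ ux _; case: insubP => // v _ vy _ [uv].
  by apply: val_inj; move: ux vy; rewrite uv /=; lia.
- case: insubP => // u _ ux _; case: ifP => // yc' _ [uv].
  by move: ux; rewrite uv /=; lia.
- case: ifP => // xc' _; case: insubP => // v _ vy _ [uv].
  by move: vy; rewrite -uv /=; lia.
by case: ifP => // _ _; case: ifP => // _ _ [].
Qed.

Definition shift c : pinj n := PInj (shift_subproof c).

Lemma shiftP c (x y : 'I_n) :
  reflect (x <= c /\ y = x + 2 :> nat \/ c + 4 <= x /\ y = x :> nat)
          (shift c x == Some y).
Proof.
rewrite ffunE; case: (leqP x c) => xc; last first.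
  case: ifP => xc'; apply: (iffP eqP) => //.
  - by case=> ->; right.
  - by case=> [[]|[_ /val_inj ->]] //; lia.
  by case=> [[]|[]]; lia.
case: insubP => [u _ /= ux|].
  apply: (iffP eqP) => [[<-]|[[_ yx]|[? _]]]; last by lia.
    by left; split=> //; rewrite ux addn2.
  by congr Some; apply: val_inj; rewrite /= ux yx addn2.
by move=> xn; apply: (iffP eqP) => // -[[_ yx]|[]]; move: (ltn_ord y); lia.
Qed.

Definition two_blocks c : {set 'I_n} := [set x : 'I_n | (x <= c) || (c + 4 <= x)].

Lemma pdom_shift c : c + 2 < n -> pdom (shift c) = two_blocks c.
Proof.
move=> cn; apply/setP => x; rewrite [RHS]inE; apply/pdomP/orP.
  by case=> y /eqP/shiftP[[]|[]]; [left|right].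
case=> xc; last by exists x; apply/eqP/shiftP; right.
have xn : x + 2 < n by lia.
by exists (Ordinal xn); apply/eqP/shiftP; left.
Qed.

Lemma shift_IOFpar c : shift c \in IOFpar n.
Proof.
apply/IOFparP; split=> [x x' /eqP/shiftP|x y x' y' /eqP/shiftP ax /eqP/shiftP ay xy].
  by case=> [[_ ->]|[_ ->]] //; lia.
case: ax ay => [[? ?]|[? ?]] [[? ?]|[? ?]]; subst; split; lia.
Qed.

Lemma shift_movers c : c + 2 < n -> shift c \in movers (two_blocks c).
Proof.
move=> cn; rewrite in_movers shift_IOFpar pdom_shift // eqxx /=.
have n0 : 0 < n by lia.
have n2 : 2 < n by lia.
apply/movesP; exists (Ordinal n0), (Ordinal n2); split=> //.
by apply/eqP/shiftP; left.
Qed.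

Lemma two_blocks_inj c d :
  c + 2 < n -> d + 2 < n -> two_blocks c = two_blocks d -> c = d.
Proof.
wlog cd : c d / c < d => [H|].
  have [lt|lt|//] := ltngtP c d; first exact: H.
  by move=> cn dn e; apply/esym/H.
move=> cn dn e; have n1 : c.+1 < n by lia.
by move/setP: e => /(_ (Ordinal n1)); rewrite !inE /=; lia.
Qed.

(** Comparing the first blocks of domain and image forces [c = d]; then domain and image coincide
    and nothing moves. *)
Lemma movers_pinv_disjoint c d a : c + 2 < n -> d + 2 < n ->
  a \in movers (two_blocks c) -> pinv a \notin movers (two_blocks d).
Proof.
move=> cn dn; rewrite !in_movers => /and3P[aS /eqP da ma].
apply/negP => /and3P[_ /eqP di _].
suff le b (bS : b \in IOFpar n) e f : f + 2 < n ->
    pdom b = two_blocks e -> pdom (pinv b) = two_blocks f -> f <= e.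
  have cd : c = d.
    apply/eqP; rewrite eqn_leq (le a aS c d) // andbT.
    by apply: (le (pinv a)); rewrite ?IOFpar_pinv ?pinvK.
  by move: ma; apply/negP; apply: pdom_pinv_fixes; rewrite // da di cd.
move=> fn db dib; case/IOFparP: bS => pb rb; rewrite leqNgt; apply/negP => ef.
(* Domain and image both contain the points up to [e]: the least point is fixed, and adjacency
   propagates this upwards. *)
have low m : m <= e -> forall x y : 'I_n, x = m :> nat -> b x = Some y -> y = m :> nat.
  elim: m => [|m IHm] me x y xm bx.
    have n0 : 0 < n by lia.
    have /pdomP[z /pinvE bz] : Ordinal n0 \in pdom (pinv b) by rewrite dib inE.
    have [zx|xz|/val_inj zx] := ltngtP z x; first by lia.
      by have [] := rb _ _ _ _ bx bz xz; rewrite /=; lia.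
    by move: bz; rewrite zx bx => -[->].
  have nm : m < n by move: (ltn_ord x); lia.
  have /pdomP[z bz] : Ordinal nm \in pdom b by rewrite db inE /=; lia.
  have := IHm (ltnW me) (Ordinal nm) z erefl bz.
  by have [|_] := rb _ _ _ _ bz bx _; rewrite /= ?xm //; lia.
have ne : e < n by lia.
have ne1 : e.+1 < n by lia.
have /pdomP[y be] : Ordinal ne \in pdom b by rewrite db inE /=; lia.
have ye := low e (leqnn e) (Ordinal ne) y erefl be.
(* The preimage of [e + 1] must lie beyond the gap, hence is not adjacent to [e], although the
   images are adjacent. *)
have /pdomP[z /pinvE bz] : Ordinal ne1 \in pdom (pinv b) by rewrite dib inE /=; lia.
have := mem_pdom bz; rewrite db inE => /orP[ze|ze].
  by have := low z ze z _ erefl bz; rewrite /=; lia.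
by have [|_] := rb _ _ _ _ be bz _; rewrite /=; lia.
Qed.

(** * Dense domains *)

(** The gap has three points, counting the one added after the chain when [c + 3 = n], so any new
    point breaks it. For [c + 4 = n] it would have four, and adding [c + 1] would leave three. *)
Lemma dense_two_blocks c D : (c + 4 < n) || (c + 3 == n) ->
  two_blocks c \proper D -> dense D.
Proof.
move=> cn /properP[/subsetP cD [u uD]]; rewrite inE negb_or -!ltnNge => /andP[cu uc].
have inD (m : nat) (mn : m < n) : (m <= c) || (c + 4 <= m) -> Ordinal mn \in D.
  by move=> mc; apply: cD; rewrite inE.
split.
- have n0 : 0 < n by move: (ltn_ord u); lia.
  by exists (Ordinal n0); rewrite ?inD.
- case/orP: cn => cn.
    have nn : n.-1 < n by lia.
    by exists (Ordinal nn); [apply: inD|rewrite /=]; lia.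
  by exists u => //; lia.
move=> x y xD yD xy.
(* The next point is [x + 1] inside the first block, [u] from there up to [u], and [x + 3] once [x]
   has reached [u], since then [x + 3 >= c + 4]. *)
have [xc|xc] := ltnP x c.
  have n1 : x.+1 < n by move: (ltn_ord y); lia.
  by exists (Ordinal n1); [apply: inD|rewrite /=]; lia.
have [xu|ux] := ltnP x u; first by exists u => //; lia.
have n3 : x + 3 < n by move: (ltn_ord y); lia.
by exists (Ordinal n3); [apply: inD|rewrite /=]; lia.
Qed.

Lemma dense_coatom i : 4 <= n -> dense [set~ i].
Proof.
move=> n4.
have n0 : 0 < n by lia.
have n1 : 1 < n by lia.
have m1 : n - 1 < n by lia.
have m2 : n - 2 < n by lia.
split.
- have [i0|i0] := eqVneq (i : nat) 0.
    by exists (Ordinal n1) => //; rewrite !inE -val_eqE /=; lia.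
  by exists (Ordinal n0) => //; rewrite !inE -val_eqE /=; lia.
- have [i0|i0] := eqVneq (i : nat) (n - 1).
    by exists (Ordinal m2) => /=; [rewrite !inE -val_eqE /=; lia|lia].
  by exists (Ordinal m1) => /=; [rewrite !inE -val_eqE /=; lia|lia].
move=> x y _ _ xy.
have x1 : x + 1 < n by move: (ltn_ord y); lia.
have x2 : x + 2 < n by move: (ltn_ord y); lia.
have [i0|i0] := eqVneq (i : nat) (x + 1).
  by exists (Ordinal x2) => /=; [rewrite !inE -val_eqE /=; lia|lia].
by exists (Ordinal x1) => /=; [rewrite !inE -val_eqE /=; lia|lia].
Qed.

Lemma dense_setT : 4 <= n -> dense [set: 'I_n].
Proof.
move=> n4; have n0 : 0 < n by lia.
have [[x _ x1] [y _ yn] gap] := dense_coatom (Ordinal n0) n4.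
split; [by exists x|by exists y|move=> u v _ _ uv].
have x1' : u + 1 < n by move: (ltn_ord v); lia.
by exists (Ordinal x1'); [rewrite inE|rewrite /=; lia].
Qed.

(** * Factoring out shifts *)

(** Pushing domain points up lowers the sum; the image is counted as well to make it invariant under
    inversion. *)
Definition weight a : nat :=
  \sum_(x in pdom a) (n - x) + \sum_(y in pdom (pinv a)) (n - y).

Lemma weight_pinv a : weight (pinv a) = weight a.
Proof. by rewrite /weight pinvK addnC. Qed.

Lemma shift_factor a c : pdom a \subset two_blocks c -> c + 2 < n ->
  a = shift c * (pinv (shift c) * a).
Proof.
move=> dc cn; apply: pinjP => x; case ax: (a x) => [z|].
  have := subsetP dc _ (mem_pdom ax); rewrite -pdom_shift // => /pdomP[y sx].
  by rewrite (mulp_some _ sx) (mulp_some _ (iffRL (pinvE _ _ _) sx)).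
case sax: ((shift c * (pinv (shift c) * a)) x) => [z|] //.
case/mulpP: sax => y sx /mulpP[u /pinvE su au].
by rewrite (pinj_inj su sx) ax in au.
Qed.

(** The image is kept, while the domain is carried along the shift, which moves [x] up and no point
    down. *)
Lemma weight_shift a c x : pdom a \subset two_blocks c -> c + 2 < n ->
  x \in pdom a -> x <= c -> weight (pinv (shift c) * a) < weight a.
Proof.
move=> dc cn xa xc; set b := pinv _ * a.
have im : pdom (pinv b) = pdom (pinv a).
  apply/setP => y; rewrite pinvM pinvK; apply/pdomP/pdomP => -[z].
    by case/mulpP => u ay _; exists u.
  move=> ay; have := mem_pdom (iffLR (pinvE _ _ _) ay).
  move/(subsetP dc); rewrite -pdom_shift // => /pdomP[u su].
  by exists u; rewrite mulpE ay.
pose h y := odflt y (shift c y).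
have hE y : y \in pdom a -> shift c y = Some (h y).
  by move/(subsetP dc); rewrite -pdom_shift // /h => /pdomP[u ->].
have db : pdom b = h @: pdom a.
  apply/setP => y; apply/pdomP/imsetP => [[z /mulpP[u /pinvE su au]]|[z za ->]].
    by exists u; [apply: mem_pdom au|rewrite /h su].
  have /pdomP[u au] := za; exists u; rewrite mulpE.
  by rewrite (iffRL (pinvE _ _ _) (hE z za)).
rewrite /weight im ltn_add2r db big_imset /=; last first.
  by move=> y z /hE sy /hE sz e; rewrite -e in sz; apply: pinj_inj sy sz.
rewrite (bigD1 x) //= [X in _ < X](bigD1 x) //= -addSn leq_add //.
  by have /eqP/shiftP := hE x xa; move: (ltn_ord x); lia.
apply: leq_sum => y /andP[/hE/eqP/shiftP hy _].
case: hy => [[_ ->]|[_ ->]]; lia.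
Qed.

(** By parity [y >= x + 2], and [z] is fixed above [y]. If [z = x + 3], then [y = x + 2] would be
    adjacent to [z] while [x] is not. *)
Lemma moved_up_bounds a x y : a \in IOFpar n -> a x = Some y -> x < y ->
    (forall z t, a z = Some t -> x < z -> t = z) ->
  x + 2 < n /\ forall z, z \in pdom a -> x < z -> x + 4 <= z.
Proof.
move=> /IOFparP[pa ra] ax xy top; move: (pa _ _ ax) (ltn_ord y) => pxy yn.
split; first by lia.
move=> z /pdomP[t az] xz; have [] := ra _ _ _ _ ax az xz.
by rewrite (top _ _ az xz); move: (pa _ _ az); lia.
Qed.

(* Enumerates the cut points 0, ..., n - 5, n - 3.  The cut point n - 4 is left
   out: its first block is {0, ..., n - 4} and its second one is empty, so that
   its shift is a restriction of the one at n - 3. *)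
Definition cut k : nat := if k + 4 == n then k.+1 else k.

Lemma moved_up_factor a x y : 4 <= n -> a \in IOFpar n -> a x = Some y -> x < y ->
    (forall z t, a z = Some t -> x < z -> t = z) ->
  exists2 k, k < n - 3 &
    a = shift (cut k) * (pinv (shift (cut k)) * a) /\
    weight (pinv (shift (cut k)) * a) < weight a.
Proof.
move=> n4 aS ax xy top; have [xn gap] := moved_up_bounds aS ax xy top.
(* Both [x = n - 3] and [x = n - 4] use index [n - 4], whose cut point is [n - 3]; a smaller [x] is
   its own cut point. *)
exists (if x + 3 == n then x.-1 else x); first by case: eqP; lia.
set c := cut _; have [cn xc] : c + 2 < n /\ x <= c.
  by rewrite /c /cut; do 2?case: eqP; lia.
have dc : pdom a \subset two_blocks c.
  apply/subsetP => z za; rewrite inE; move: (gap z za) (ltn_ord z).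
  by rewrite /c /cut; do 2?case: eqP; lia.
by split; [apply: shift_factor|apply: (weight_shift dc cn (mem_pdom ax) xc)].
Qed.

(** * The generating set *)

(** The index type has n + 2(n - 3) elements and also indexes the prime classes, so that each
    generator represents its own class. *)
Definition generator (u : 'I_n + bool * 'I_(n - 3)) : pinj n :=
  match u with
  | inl i => restr [set~ i]
  | inr (false, k) => shift (cut k)
  | inr (true, k) => pinv (shift (cut k))
  end.

Definition generators : {set pinj n} := generator @: setT.

Lemma generator_generated u : generator u \in generated generators.
Proof. by apply: (subsetP (sub_generated _)); apply: imset_f. Qed.

(** Missing points are removed one at a time. *)
Lemma restr_generated D : restr D \in generated generators.
Proof.
have mG := generated_submonoid generators.
have [m] := ubnP #|~: D|; elim: m D => // m IHm D; rewrite ltnS => Dm.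
have [DT|/set0Pn[i iD]] := eqVneq (~: D) set0.
  by rewrite -(setCK D) DT setC0 restrT; case/andP: mG.
have -> : D = (i |: D) :&: [set~ i].
  apply/setP => x; move: iD; rewrite !inE.
  by have [->/negbTE|_ _] := eqVneq x i; rewrite /= ?andbT.
rewrite -restrI submonoidM //; last exact: (generator_generated (inl i)).
apply: IHm; apply: leq_trans Dm; rewrite setCU -setDE setDE setIC -setDE.
by rewrite [X in _ < X](cardsD1 i) iD.
Qed.

Lemma generators_pinv a : a \in generated generators -> pinv a \in generated generators.
Proof.
apply: generated_pinv => _ /imsetP[[i|[[] k]] _ ->] /=.
- rewrite (restr_pdom (a := pinv _)) ?moves_pinv ?moves_restr //.
  exact: restr_generated.
- by rewrite pinvK; apply: (generator_generated (inr (false, k))).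
exact: (generator_generated (inr (true, k))).
Qed.

Lemma generator_IOFpar u : generator u \in IOFpar n.
Proof.
case: u => [i|[[] k]] /=; [exact: restr_IOFpar| |exact: shift_IOFpar].
exact/IOFpar_pinv/shift_IOFpar.
Qed.

Lemma IOFpar_generated a : 4 <= n -> a \in IOFpar n -> a \in generated generators.
Proof.
move=> n4; have [m] := ubnP (weight a); elim: m a => // m IHm a; rewrite ltnS => am aS.
have [ma|ma] := boolP (moves a); last by rewrite (restr_pdom ma) restr_generated.
have up b x y : weight b <= m -> b \in IOFpar n -> b x = Some y -> x < y ->
    (forall z t, b z = Some t -> x < z -> t = z) -> b \in generated generators.
  move=> bm bS bx xy top.
  have [k kn [eb lt]] := moved_up_factor n4 bS bx xy top; rewrite eb.
  apply: submonoidM; first exact: generated_submonoid.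
    exact: (generator_generated (inr (false, Ordinal kn))).
  apply: IHm; first exact: leq_trans lt bm.
  by rewrite IOFparM // IOFpar_pinv // shift_IOFpar.
have [x0 [y0 [ax0 yx0]]] := movesP _ ma.
pose P x := (x \in pdom a) && (a x != Some x).
have Px0 : P x0.
  by rewrite /P (mem_pdom ax0) ax0; apply: contraNneq yx0 => -[->].
case: (arg_maxnP (fun x : 'I_n => x : nat) Px0) => x /andP[/pdomP[y ax] nx] xmax.
have top z t : a z = Some t -> x < z -> t = z.
  move=> az xz; apply/eqP; apply: contraTT xz => tz; rewrite -leqNgt; apply: xmax.
  by rewrite /P (mem_pdom az) az; apply: contraNneq tz => -[->].
have [lt|gt|/val_inj eq] := ltngtP x y; last by rewrite ax eq eqxx in nx.
  exact: up ax lt top.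
(* The inverse has the same weight and moves [y] up to [x]; its domain points above [y] come from
   points above [x], which are fixed. *)
rewrite -(pinvK a); apply: generators_pinv.
apply: (up (pinv a) y x); rewrite ?weight_pinv ?IOFpar_pinv //; first exact/pinvE.
move=> z t /pinvE at_ yz; have [xt|tx|/val_inj eq] := ltngtP x t.
- exact/esym/(top _ _ at_ xt).
- by case/IOFparP: aS => _ ra; have [] := ra _ _ _ _ at_ ax tx; lia.
by move: yz; rewrite -eq ax in at_; case: at_ => ->; rewrite ltnn.
Qed.

Lemma generated_generators : 4 <= n -> generated generators = IOFpar n.
Proof.
move=> n4; apply/eqP; rewrite eqEsubset; apply/andP; split.
  apply: generated_min; first exact: IOFpar_submonoid.
  by apply/subsetP => _ /imsetP[u _ ->]; apply: generator_IOFpar.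
by apply/subsetP => a; apply: IOFpar_generated.
Qed.

Lemma card_generator_index : 4 <= n -> #|{: 'I_n + bool * 'I_(n - 3)}| = (3 * n - 6)%N.
Proof. by move=> n4; rewrite card_sum card_prod card_bool !card_ord; lia. Qed.

(** * Lower bound from disjoint prime classes *)

Lemma in_preimset (f : pinj n -> pinj n) C a : (a \in f @^-1: C) = (f a \in C).
Proof. by rewrite in_set. Qed.

Definition prime_class (u : 'I_n + bool * 'I_(n - 3)) : {set pinj n} :=
  match u with
  | inl i => [set restr [set~ i]]
  | inr (false, k) => movers (two_blocks (cut k))
  | inr (true, k) => @pinv n @^-1: movers (two_blocks (cut k))
  end.

Lemma cut_bound k : 4 <= n -> k < n - 3 ->
  cut k + 2 < n /\ (cut k + 4 < n) || (cut k + 3 == n).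
Proof. by rewrite /cut; case: eqP; lia. Qed.

Lemma generator_prime_class u : 4 <= n -> generator u \in prime_class u.
Proof.
move=> n4; case: u => [i|[[] k]] /=; first by rewrite in_set1.
  by rewrite in_preimset pinvK shift_movers //; have [] := cut_bound n4 (ltn_ord k).
by rewrite shift_movers //; have [] := cut_bound n4 (ltn_ord k).
Qed.

Lemma prime_class_not1 u : 1 \notin prime_class u.
Proof.
have m1 : ~~ moves 1 by rewrite -restrT moves_restr.
case: u => [i|[[] k]] /=; rewrite ?in_preimset ?in_movers.
- rewrite inE; apply/eqP => /(congr1 pdom); rewrite -restrT !pdom_restr => /setP/(_ i).
  by rewrite !inE eqxx.
- by rewrite moves_pinv (negbTE m1) !andbF.
by rewrite (negbTE m1) !andbF.
Qed.

Lemma prime_class_prime u : 4 <= n ->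
  {in IOFpar n &, forall a b,
    a * b \in prime_class u -> (a \in prime_class u) || (b \in prime_class u)}.
Proof.
move=> n4; case: u => [i|[e k]].
  by apply: coatom_prime; [apply: dense_coatom|apply: dense_setT].
have [_ ck] := cut_bound n4 (ltn_ord k).
have pr := movers_prime (fun E => dense_two_blocks (D := E) ck).
case: e => a b aS bS; last exact: pr.
(* Inversion reverses the product, so the two factors trade places. *)
rewrite /= !in_preimset pinvM orbC.
by apply: pr; apply: IOFpar_pinv.
Qed.

Lemma cut_inj (k l : 'I_(n - 3)) : cut k = cut l -> k = l.
Proof.
move=> e; apply: val_inj; move: (ltn_ord k) (ltn_ord l) e; rewrite /cut /=.
by do 2?case: eqP; lia.
Qed.

Lemma prime_class_moves a e k : a \in prime_class (inr (e, k)) -> moves a.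
Proof. by case: e; rewrite /= ?in_preimset in_movers ?moves_pinv => /and3P[]. Qed.

(** Restrictions move nothing, unlike the other classes; those are separated by their domains, by
    their images, or by [movers_pinv_disjoint]. *)
Lemma prime_class_disjoint a u v : 4 <= n ->
  a \in prime_class u -> a \in prime_class v -> u = v.
Proof.
move=> n4.
have cn (k : 'I_(n - 3)) : cut k + 2 < n by have [] := cut_bound n4 (ltn_ord k).
have eq_movers b (k l : 'I_(n - 3)) : b \in movers (two_blocks (cut k)) ->
    b \in movers (two_blocks (cut l)) -> k = l.
  rewrite !in_movers => /and3P[_ /eqP-> _] /and3P[_ /eqP e _].
  exact/cut_inj/(two_blocks_inj (cn k) (cn l) e).
have no_restr i e k : a \in prime_class (inl i) -> a \notin prime_class (inr (e, k)).
  by rewrite inE => /eqP->; apply/negP => /prime_class_moves; apply/negP/moves_restr.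
case: u => [i|[e k]]; case: v => [j|[f l]] au av.
- move: au av; rewrite !inE => /eqP-> /eqP/(congr1 pdom).
  by rewrite !pdom_restr => /setP/(_ i); rewrite !inE eqxx => /esym/negbFE/eqP ->.
- by rewrite (negbTE (no_restr _ _ _ au)) in av.
- by rewrite (negbTE (no_restr _ _ _ av)) in au.
case: e f au av => [] [] /=; rewrite ?in_preimset => au av.
- by rewrite (eq_movers _ _ _ au av).
- by rewrite (negbTE (movers_pinv_disjoint (cn l) (cn k) av)) in au.
- by rewrite (negbTE (movers_pinv_disjoint (cn k) (cn l) au)) in av.
by rewrite (eq_movers _ _ _ au av).
Qed.

Lemma card_generating_set A : 4 <= n -> generated A = IOFpar n -> 3 * n - 6 <= #|A|.
Proof.
move=> n4 AS; rewrite -card_generator_index //.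
have /fin_all_exists2[f fA fC] u : exists2 a, a \in A & a \in prime_class u.
  apply: (prime_class_meets (IOFpar_submonoid n) AS (generator_IOFpar u)).
  - exact: generator_prime_class.
  - exact: prime_class_not1.
  exact: prime_class_prime.
(* An element chosen for two classes would lie in both. *)
have f_inj : injective f.
  by move=> u v fuv; apply: (prime_class_disjoint n4 (fC u)); rewrite fuv.
rewrite -(card_codom f_inj); apply: subset_leq_card.
by apply/subsetP => _ /codomP[u ->].
Qed.

End PartialInjections.

Theorem theorem2 (n : nat) (hn : 4 <= n) : rank (IOFpar n) = 3 * n - 6.
Proof.
rewrite /rank; case: arg_minnP => [|A /eqP AS Amin].
  by rewrite generated_id ?IOFpar_submonoid.
apply/eqP; rewrite eqn_leq card_generating_set // andbT.
apply: leq_trans (Amin _ _) _; first exact/eqP/generated_generators.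
by rewrite -card_generator_index // -cardsT leq_imset_card.
Qed.
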